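(* Let $\mathcal{X}^2$ be a smooth complete Riemannian manifold (no smooth structure is required on $\mathcal{X}^1$). For some $p\ge1$ let $\pi=e^{-f}\in\mathcal{P}_p(\mathcal{X}^1\times\mathcal{X}^2)$. Let $\mu_\star^2\in\mathcal{P}_p(\mathcal{X}^2)$ be a fixed point, $\mu_\star^2=\mu_\star^2[\mu_\star^1[\mu_\star^2]]$. Assume: (i) the composed optimality map $\mu_\star^2[\mu_\star^1[\cdot]]:\mathcal{P}(\mathcal{X}^2)\to\mathcal{P}(\mathcal{X}^2)$ is Fisher-smooth with constant $L_2$ at $B_{\varepsilon_2}(\mu_\star^2)$; (ii) $\mu_\star^2$ satisfies a transportation-information inequality with constant $\lambda_2$. Suppose $L_2<\lambda_2$ and let $k\ge1$. Let $(\mu_k^2)_k$ be the second-coordinate iterates of the two-block sequential CAVI algorithm, so that $\mu_{k+1}^2=\mu_\star^2[\mu_\star^1[\mu_k^2]]$. Then, whenever $\mu_k^2\in B_{\varepsilon_2}(\mu_\star^2)$, $$\mathbb{W}_p(\mu_{k+1}^2,\mu_\star^2)\le\frac{L_2}{\lambda_2}\,\mathbb{W}_p(\mu_k^2,\mu_\star^2).$$ In particular, $\mu_{k+1}^2\in B_{\varepsilon_2}(\mu_\star^2)$, and $(\mu_k^2)_{k\ge0}$ converges exponentially fast to $\mu_\star^2$ in Wasserstein-$p$ distance with rate $\frac{L_2}{\lambda_2}$ (that is, the one-step bound holds at every subsequent iteration).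
   Context: $\mathcal{X}^1$ is a metric space with a reference measure (for instance a Riemannian manifold with its volume measure, or a discrete space with counting measure); $\mathcal{X}^2$ has geodesic distance $\mathsf{d}$ and its volume measure. $\mathcal{P}(\mathcal{X})$ is the set of probability measures, $\mathcal{P}_p(\mathcal{X})$ those absolutely continuous with respect to the reference measure with finite $p$-th moment. Measures are identified with their densities; $\pi=e^{-f}$ means $\pi$ has density $e^{-f}$ with respect to the product reference measure. Wasserstein distance: $\mathbb{W}_p(\varrho_1,\varrho_2)=\inf_{\gamma}\left(\int \mathsf{d}(x_1,x_2)^p\,\gamma(dx_1,dx_2)\right)^{1/p}$, infimum over couplings $\gamma$ of $\varrho_1,\varrho_2$. Ball: $B_\varepsilon(\varrho)=\{\mu\in\mathcal{P}_p(\mathcal{X}^2):\mathbb{W}_p(\mu,\varrho)<\varepsilon\}$, $\varepsilon\in(0,\infty]$. Relative Fisher information: $\mathcal{I}(\varrho_1\|\varrho_2)=\int|\nabla\log\frac{d\varrho_1}{d\varrho_2}|^2\,d\varrho_1$ if $\varrho_1\ll\varrho_2$, and $+\infty$ otherwise. Fisher-smoothness: $\gamma_\star[\cdot]:\mathcal{P}(\mathcal{X}^2)\to\mathcal{P}(\mathcal{X}^2)$ is Fisher-smooth with constant $L\ge0$ at $B_\varepsilon(\nu)$ if $\mathcal{I}(\gamma_\star[\mu]\|\gamma_\star[\nu])\le L^2\,\mathbb{W}_p^2(\mu,\nu)$ for all $\mu\in B_\varepsilon(\nu)$. Transportation-information inequality: $\gamma\in\mathcal{P}_p(\mathcal{X}^2)$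 satisfies it with constant $\lambda>0$ if $\lambda^2\,\mathbb{W}_p^2(\mu,\gamma)\le\mathcal{I}(\mu\|\gamma)$ for all $\mu\in\mathcal{P}(\mathcal{X}^2)$ with $\mu\ll\gamma$. Optimality maps: $\mu_\star^1[\nu^2](x_1)\propto\exp(-\mathbb{E}_{X_2\sim\nu^2}f(x_1,X_2))$ and $\mu_\star^2[\nu^1](x_2)\propto\exp(-\mathbb{E}_{X_1\sim\nu^1}f(X_1,x_2))$ (densities with respect to the reference measures), assumed to be well defined at the measures to which they are applied. Two-block sequential CAVI: from an initial $\mu_0^2$, for $k\ge0$, $\mu_{k+1}^1=\mu_\star^1[\mu_k^2]$ and $\mu_{k+1}^2=\mu_\star^2[\mu_{k+1}^1]$. *)

(* Defs.v *)
From HB Require Import structures.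
From mathcomp Require Import all_boot all_order all_algebra.
From mathcomp Require Import all_classical all_reals all_analysis.
From mathcomp Require Import measurable_realfun metric_structure.

Set Implicit Arguments.
Unset Strict Implicit.
Unset Printing Implicit Defensive.

Import Order.TTheory GRing.Theory Num.Theory.
Import numFieldNormedType.Exports.

Local Open Scope classical_set_scope.
Local Open Scope ring_scope.

(* The Borel sigma-algebra of the library is on pointed types; a space carrying
   a probability measure is nonempty anyway. *)
#[short(type="pmetricType")]
HB.structure Definition PointedMetric (R : numDomainType) :=
  {T of Pointed T & Metric R T}.

Notation Borel X := (g_sigma_algebraType (@open X)).

(** * Calculus on R^n *)

Section calculus.
Context {R : realType}.

(* [\int ... \int F dx_1 ... dx_n]: by Tonelli, the integral of a nonnegative
   Borel function against n-dimensional Lebesgue measure. *)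
Fixpoint iterated_integral (n : nat) : ('rV[R]_n -> \bar R) -> \bar R :=
  match n with
  | 0%N => fun F => F 0
  | m.+1 => fun F => (\int[@lebesgue_measure R]_t
      iterated_integral (fun y : 'rV[R]_m => F (row_mx (t%:M : 'rV[R]_1) y)))%E
  end.

Definition iterated_derivative (n : nat) (f : 'rV[R]_n -> R)
    (vs : seq 'rV[R]_n) : 'rV[R]_n -> R :=
  foldr (fun v g => 'D_v g) f vs.

(* C^infinity on an open set [U]: the directional derivatives of all orders
   exist and are continuous. *)
Definition smooth_on (n : nat) (U : set 'rV[R]_n) (f : 'rV[R]_n -> R) :=
  forall vs x, U x ->
    {for x, continuous (iterated_derivative f vs)} /\
    (forall v, derivable (iterated_derivative f vs) x v).

Definition test_function (n : nat) (U : set 'rV[R]_n) (psi : 'rV[R]_n -> R) :=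
  smooth_on setT psi /\
  exists K, [/\ compact K, K `<=` U & forall y, ~ K y -> psi y = 0].

End calculus.

(** * Riemannian manifolds *)

(* An atlas with one preferred chart [chart a : chart_dom a -> 'rV_n] around each
   point [a]; [chart_inv a] is the inverse chart.  The tangent space at [x] is
   'rV_n, through the coordinates of the preferred chart at [x], and [riem_metric x]
   is the Gram matrix of the inner product on it. *)
Record chart_data (R : realType) (M : pmetricType R) (n : nat) := ChartData {
  chart_dom : M -> set M ;
  chart : M -> M -> 'rV[R]_n ;
  chart_inv : M -> 'rV[R]_n -> M ;
  riem_metric : M -> 'M[R]_n }.

Section riemannian.
Context {R : realType} {M : pmetricType R} {n : nat} (S : chart_data M n).

Definition chart_image (a : M) : set 'rV[R]_n := chart S a @` chart_dom S a.

(* Row [i] is the [i]-th coordinate vector field of the chart at [a], taken at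
   the point [chart_inv S a y] and expressed in the tangent space of that point. *)
Definition frame (a : M) (y : 'rV[R]_n) : 'M[R]_n :=
  'J (chart S (chart_inv S a y) \o chart_inv S a) y.

(* The coefficients g_ij of the Riemannian metric in the chart at [a]. *)
Definition gram (a : M) (y : 'rV[R]_n) : 'M[R]_n :=
  frame a y *m riem_metric S (chart_inv S a y) *m (frame a y)^T.

Definition volume_density (a : M) (y : 'rV[R]_n) : R :=
  Num.sqrt (\det (gram a y)).

Definition tangent_sqnorm (x : M) (v : 'rV[R]_n) : R :=
  (v *m riem_metric S x *m v^T) 0 0.

Definition velocity (c : R -> M) (t : R) : 'rV[R]_n :=
  derive1 (chart S (c t) \o c) t.

Definition C1_curve (c : R -> M) :=
  continuous c /\
  forall t, (\forall s \near t, derivable (chart S (c t) \o c) s 1) /\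
            {for t, continuous (derive1 (chart S (c t) \o c))}.

Definition curve_length (c : R -> M) : \bar R :=
  (\int[@lebesgue_measure R]_(t in `[0%R, 1%R])
     (Num.sqrt (tangent_sqnorm (c t) (velocity c t)))%:E)%E.

(* Curves need not be regular: a piecewise C^1 curve can be slowed down to a
   stop at its corners, so the infimum is the same as over piecewise C^1
   curves. *)
Definition geodesic_distance (x y : M) : \bar R :=
  ereal_inf [set curve_length c | c in
    [set c | [/\ C1_curve c, c 0 = x & c 1 = y]]].

(* Since [mdist] is real-valued, [mdist_geodesic] also makes [M] connected. *)
Record complete_riemannian_manifold : Prop := CompleteRiemannianManifold {
  chart_dom_open : forall a, open (chart_dom S a) ;
  chart_dom_center : forall a, chart_dom S a a ;
  chart_image_open : forall a, open (chart_image a) ;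
  chartK : forall a x, chart_dom S a x -> chart_inv S a (chart S a x) = x ;
  chart_continuous :
    forall a x, chart_dom S a x -> {for x, continuous (chart S a)} ;
  chart_inv_continuous :
    forall a y, chart_image a y -> {for y, continuous (chart_inv S a)} ;
  transition_smooth : forall a b j,
    smooth_on (chart S a @` (chart_dom S a `&` chart_dom S b))
              (fun y => chart S b (chart_inv S a y) 0 j) ;
  manifold_second_countable : @second_countable M ;
  metric_symmetric : forall x, (riem_metric S x)^T = riem_metric S x ;
  metric_positive : forall x v, v != 0 -> 0 < tangent_sqnorm x v ;
  metric_smooth : forall a i j,
    smooth_on (chart_image a) (fun y => gram a y i j) ;
  mdist_geodesic : forall x y : M, (mdist x y)%:E = geodesic_distance x y ;
  mdist_complete : forall u : nat -> M,
    cauchy (u @ \oo) -> exists x : M, u @ \oo --> x }.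

Definition volume_measure (vol : set (Borel M) -> \bar R) :=
  forall (a : M) (A : set (Borel M)), measurable A -> A `<=` chart_dom S a ->
    vol A = iterated_integral (fun y : 'rV[R]_n =>
      (\1_(chart S a @` A) y * volume_density a y)%:E).

(* The [i]-th component of the differential dual to the vector field [V], in
   the chart at [a]: the inner product of [V x] with the [i]-th coordinate
   vector. *)
Definition partial (V : M -> 'rV[R]_n) (a : M) (i : 'I_n) (x : M) : R :=
  (V x *m riem_metric S x *m (frame a (chart S a x))^T) 0 i.

(* [h] is locally integrable with locally integrable distributional gradient
   [V]: in each chart,
     \int h d_i(psi) dy = - \int (d_i h) psi dy  for all test functions psi,
   where the coordinate Lebesgue measure is written dy = dvol / sqrt(det g). *)
Definition weak_gradient (vol : set (Borel M) -> \bar R)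
    (h : M -> R) (V : M -> 'rV[R]_n) :=
  forall a : M,
    (forall K : set (Borel M), compact (K : set M) -> K `<=` chart_dom S a ->
       vol.-integrable K (fun x => (h x)%:E) /\
       forall i, vol.-integrable K (fun x => (partial V a i x)%:E)) /\
    (forall (psi : 'rV[R]_n -> R) (i : 'I_n),
       test_function (chart_image a) psi ->
       (\int[vol]_(x in (chart_dom S a : set (Borel M)))
          (h x * 'D_(delta_mx 0 i) psi (chart S a x)
             / volume_density a (chart S a x))%:E =
        - \int[vol]_(x in (chart_dom S a : set (Borel M)))
          (partial V a i x * psi (chart S a x)
             / volume_density a (chart S a x))%:E)%E).

End riemannian.

(** * Probability measures, Wasserstein distance, Fisher information *)

Definition has_density (d : measure_display) (T : measurableType d)
    (R : realType) (ref : set T -> \bar R) (g : T -> \bar R)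
    (mu : set T -> \bar R) :=
  [/\ measurable_fun setT g, forall x, (0 <= g x)%E &
      forall A, measurable A -> mu A = (\int[ref]_(x in A) g x)%E].

(* The set P_p: absolutely continuous with respect to [ref], with finite
   [p]-th moment for [dist]. *)
Definition in_Pp (d : measure_display) (T : measurableType d) (R : realType)
    (ref : set T -> \bar R) (dist : T -> T -> R) (p : R)
    (mu : probability T R) :=
  mu `<< ref /\ exists x0, (\int[mu]_x ((dist x0 x) `^ p)%:E < +oo)%E.

(* The sup product metric; the other usual product metrics are equivalent to it
   and give the same P_p. *)
Definition prod_dist (R : realType) (X Y : pmetricType R)
    (z w : Borel X * Borel Y) : R :=
  Num.max (mdist (z.1 : X) w.1) (mdist (z.2 : Y) w.2).

Definition coupling (d : measure_display) (T : measurableType d) (R : realType)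
    (mu nu : probability T R) (gamma : probability (T * T)%type R) :=
  forall A : set T, measurable A ->
    gamma (A `*` setT) = mu A /\ gamma (setT `*` A) = nu A.

Definition wasserstein (R : realType) (X : pmetricType R) (p : R)
    (mu nu : probability (Borel X) R) : \bar R :=
  ((ereal_inf [set \int[gamma]_z ((mdist (z.1 : X) z.2) `^ p)%:E
                 | gamma in [set gamma | coupling mu nu gamma]]) `^ p^-1)%E.

Definition wasserstein_ball (R : realType) (X : pmetricType R)
    (ref : set (Borel X) -> \bar R) (p : R) (eps : \bar R)
    (nu : probability (Borel X) R) : set (probability (Borel X) R) :=
  [set mu | in_Pp ref (@mdist R X) p mu /\ (wasserstein p mu nu < eps)%E].

(* [h] ranges over the versions of d(rho1)/d(rho2) and [V] over the weak
   gradients of [h], so that [V / h] is the gradient of [log h]; the density is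
   not required to be positive, only [rho1]-almost all points matter.  When
   [rho2] has a positive density, [h] and [V] are unique almost everywhere and
   the infimum is over at most one value; it is [+oo] if no version of the
   density is weakly differentiable. *)
Definition fisher_information (R : realType) (X : pmetricType R) (n : nat)
    (S : chart_data X n) (vol : set (Borel X) -> \bar R)
    (rho1 rho2 : probability (Borel X) R) : \bar R :=
  if `[< rho1 `<< rho2 >] then
    ereal_inf [set I | exists (h : Borel X -> R) (V : X -> 'rV[R]_n),
      [/\ has_density rho2 (fun x => (h x)%:E) rho1,
          weak_gradient S vol h V &
          I = (\int[rho1]_x (tangent_sqnorm S x ((h x)^-1 *: V x))%:E)%E]]
  else +oo%E.

Definition fisher_smooth (R : realType) (X : pmetricType R) (n : nat)
    (S : chart_data X n) (vol : set (Borel X) -> \bar R) (p : R)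
    (T : probability (Borel X) R -> probability (Borel X) R)
    (L : R) (eps : \bar R) (nu : probability (Borel X) R) :=
  0 <= L /\
  forall mu, wasserstein_ball vol p eps nu mu ->
    (fisher_information S vol (T mu) (T nu)
       <= (L ^+ 2)%:E * wasserstein p mu nu ^+ 2)%E.

Definition transport_information (R : realType) (X : pmetricType R) (n : nat)
    (S : chart_data X n) (vol : set (Borel X) -> \bar R) (p lambda : R)
    (gamma : probability (Borel X) R) :=
  0 < lambda /\
  forall mu : probability (Borel X) R, mu `<< gamma ->
    ((lambda ^+ 2)%:E * wasserstein p mu gamma ^+ 2
       <= fisher_information S vol mu gamma)%E.

(** * Mean-field optimality maps and CAVI *)

Section optimality.
Context {R : realType} {d1 d2 : measure_display}.
Context {X : measurableType d1} {Y : measurableType d2}.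
Variables (ref : set X -> \bar R) (f : X -> Y -> R).

Definition optimality_weight (nu : probability Y R) (x : X) : \bar R :=
  expeR (- \int[nu]_y (f x y)%:E)%E.

Definition optimality_constant (nu : probability Y R) : \bar R :=
  (\int[ref]_x optimality_weight nu x)%E.

(* The expectation exists in ]-oo, +oo] for almost every [x], and the weight
   can be normalized. *)
Definition optimality_defined (nu : probability Y R) :=
  {ae ref, forall x, (\int[nu]_y (fun y => (f x y)%:E)^\- y < +oo)%E} /\
  (0 < optimality_constant nu < +oo)%E.

(* The values of [T] at measures where the formula makes no sense are left
   unspecified. *)
Definition optimality_map (T : probability Y R -> probability X R) :=
  forall nu, optimality_defined nu ->
    forall A, measurable A ->
      T nu A = ((\int[ref]_(x in A) optimality_weight nu x)
                  * ((fine (optimality_constant nu))^-1)%:E)%E.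

End optimality.

Section cavi.
Context {R : realType} {d1 d2 : measure_display}.
Context {X1 : measurableType d1} {X2 : measurableType d2}.
Variables (ref1 : set X1 -> \bar R) (ref2 : set X2 -> \bar R).
Variable f : X1 * X2 -> R.
Variables (T1 : probability X2 R -> probability X1 R)
          (T2 : probability X1 R -> probability X2 R).

Definition composed_defined (nu : probability X2 R) :=
  optimality_defined ref1 (fun x1 x2 => f (x1, x2)) nu /\
  optimality_defined ref2 (fun x2 x1 => f (x1, x2)) (T1 nu).

(* [mu1 0] plays no role: the algorithm starts from [mu2 0]. *)
Definition sequential_cavi (mu1 : nat -> probability X1 R)
    (mu2 : nat -> probability X2 R) :=
  forall k, [/\ composed_defined (mu2 k),
                mu1 k.+1 = T1 (mu2 k) & mu2 k.+1 = T2 (mu1 k.+1)].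

End cavi.

(* Main.v *)
(* With W the Wasserstein distance to the fixed point nu and T the composed
   optimality map, chaining (ii) at T mu with (i) at mu gives
     lambda^2 W(T mu)^2 <= I(T mu || nu) <= L^2 W(mu)^2.
   T mu stays in the ball: the Fisher information bounded by (i) is finite, so
   T mu << nu, and a coupling of finite cost with nu bounds the p-th moment of
   T mu. *)
Require Import Defs.
From HB Require Import structures.
From mathcomp Require Import all_boot all_order all_algebra.
From mathcomp Require Import all_classical all_reals all_analysis.
From mathcomp Require Import measurable_realfun metric_structure.

Set Implicit Arguments.
Unset Strict Implicit.
Unset Printing Implicit Defensive.

Import Order.TTheory GRing.Theory Num.Theory.
Import numFieldNormedType.Exports.

Local Open Scope classical_set_scope.
Local Open Scope ring_scope.

Local Open Scope ereal_scope.

(* Unlike in [ge0_le_integral], [g] need not be measurable: the integral of a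
   nonnegative function is a supremum over simple functions below it. *)
Lemma ge0_le_integral_lower d (T : measurableType d) (R : realType)
    (mu : {measure set T -> \bar R}) (f g : T -> \bar R) :
  (forall x, 0 <= f x) -> (forall x, f x <= g x) ->
  \int[mu]_x f x <= \int[mu]_x g x.
Proof.
move=> f0 fg; rewrite !ge0_integralTE// => [|x]; last exact: le_trans (fg x).
apply: le_ereal_sup; apply: image_subset => h hf x.
exact: le_trans (fg x).
Qed.

(** Open rays unbounded below generate the Borel sets of the line, and their preimages are open by
    the triangle inequality. *)
Lemma measurable_mdist (R : realType) (X : pmetricType R) (x : X) :
  measurable_fun setT (mdist x : Borel X -> R).
Proof.
apply: (measurability _ (RGenInftyO.measurableE R)) => //.
move=> _ [_ [r ->] <-]; rewrite setTI.
apply: sub_sigma_algebra.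
rewrite openE => y /=; rewrite in_itv/= => xyr.
apply/nbhs_ballP; exists (r - mdist x y)%R => /=; first by rewrite subr_gt0.
move=> z; rewrite ballEmdist/= => yz; rewrite in_itv/=.
by rewrite (le_lt_trans (metric_triangle x y z))// -ltrBrDl.
Qed.

Section coupling_integral.
Context d (T : measurableType d) (R : realType).
Variables (mu nu : probability T R) (gamma : probability (T * T)%type R).
Hypothesis gammaP : coupling mu nu gamma.
Variable g : T -> \bar R.
Hypotheses (mg : measurable_fun setT g) (g0 : forall x, 0 <= g x).

(** The first marginal of [gamma] is its pushforward by [fst], since the preimage of [A] is the
    cylinder over [A]; the claim is then a change of variables. *)
Lemma coupling_integral_fst : \int[gamma]_z g z.1 = \int[mu]_x g x.
Proof.
transitivity (\int[pushforward gamma fst]_x g x).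
  by rewrite ge0_integral_pushforward.
apply: eq_measure_integral => A mA _; rewrite /= /pushforward.
have <- := (gammaP mA).1.
by congr (gamma _); apply/seteqP; split=> z //= [].
Qed.

Lemma coupling_integral_snd : \int[gamma]_z g z.2 = \int[nu]_x g x.
Proof.
transitivity (\int[pushforward gamma snd]_x g x).
  by rewrite ge0_integral_pushforward.
apply: eq_measure_integral => A mA _; rewrite /= /pushforward.
have <- := (gammaP mA).2.
by congr (gamma _); apply/seteqP; split=> z //= [].
Qed.

End coupling_integral.

(** A sum of two distances is at most twice their maximum, and the [p]-th power of the maximum is
    one of the two powers. The crude constant [2 ^ p] avoids any convexity argument. *)
Lemma powR_mdist_triangle (R : realType) (X : metricType R) (p : R) (x y z : X) :
  (0 <= p)%R ->
  (mdist x z `^ p <= 2 `^ p * (mdist x y `^ p + mdist y z `^ p))%R.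
Proof.
move=> p0.
set a := mdist x y; set b := mdist y z.
have a0 : (0 <= a)%R := mdist_ge0 _ _.
have b0 : (0 <= b)%R := mdist_ge0 _ _.
have m0 : (0 <= Num.max a b)%R by rewrite le_max a0.
apply: (@le_trans _ _ ((2 * Num.max a b) `^ p)%R).
  apply: ge0_ler_powR; rewrite ?nnegrE ?mdist_ge0 ?mulr_ge0//.
  rewrite (le_trans (metric_triangle x y z))// mulr_natl mulr2n.
  by rewrite lerD// le_max lexx ?orbT.
rewrite powRM// ler_wpM2l ?powR_ge0//.
by rewrite /Num.max; case: ifP => _; rewrite ?lerDl ?lerDr powR_ge0.
Qed.

Lemma wasserstein_finite_moment (R : realType) (X : pmetricType R) (p : R)
    (mu nu : probability (Borel X) R) (x0 : X) :
  (0 < p)%R -> wasserstein p mu nu < +oo ->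
  \int[nu]_x (mdist x0 x `^ p)%:E < +oo ->
  \int[mu]_x (mdist x0 x `^ p)%:E < +oo.
Proof.
(* As [p^-1] is nonzero, a finite root means a finite infimum, hence some coupling [gamma] of
   finite, not necessarily minimal, cost. *)
move=> p0 /lty_poweRy; rewrite invr_eq0 gt_eqF// => /(_ isT).
move=> /ereal_inf_lt[_ [gamma gammaP <-] cost] nu_moment.
pose m (x : Borel X) := (mdist x0 x `^ p)%R.
have mm : measurable_fun setT m.
  by apply: (measurableT_comp (measurable_powR p)); exact: measurable_mdist.
have m0 x : (0 <= m x)%R := powR_ge0 _ _.
have mE : measurable_fun setT (EFin \o m) by exact/measurable_EFinP.
have m1 : measurable_fun setT (fun z : Borel X * Borel X => m z.1).
  exact: measurableT_comp mm _.
have m2 : measurable_fun setT (fun z : Borel X * Borel X => m z.2).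
  exact: measurableT_comp mm _.
pose c : R := (2 `^ p)%R.
have c0 : (0 < c)%R by rewrite powR_gt0.
(* The distance need not be measurable for the product sigma-algebra, so the
   triangle inequality is integrated through this measurable minorant of
   [mdist z.1 z.2 `^ p]. *)
pose g (z : Borel X * Borel X) := Num.max 0%R (c^-1 * m z.1 - m z.2)%R.
have mg : measurable_fun setT g.
  apply: measurable_maxr => //; apply: measurable_funB => //.
  exact: measurable_funM.
have g0 z : (0 <= g z)%R by rewrite le_max lexx.
have g_int : \int[gamma]_z (g z)%:E < +oo.
  apply: le_lt_trans cost; apply: ge0_le_integral_lower => z; rewrite lee_fin//.
  rewrite ge_max powR_ge0/= lerBlDr ler_pdivrMl// addrC.
  (* The path from [x0] to [z.1] passes through [z.2], whose moment is the one known to be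
     finite. *)
  rewrite [mdist z.1 z.2]metric_sym.
  exact: (powR_mdist_triangle (x0 : X) (z.2 : X) (z.1 : X) (ltW p0)).
rewrite -(coupling_integral_fst gammaP mE)//.
(* By the choice of [g], [m z.1] is at most [c * (g z + m z.2)] pointwise. Every term here is
   measurable, so the integral splits into that of [g] and the moment of [nu]. *)
have gm : \int[gamma]_z (c%:E * ((g z)%:E + (m z.2)%:E)) < +oo.
  rewrite ge0_integralZl_EFin ?ltW//; last first.
  - by apply: emeasurable_funD; exact/measurable_EFinP.
  - by move=> z _; rewrite adde_ge0// lee_fin.
  rewrite ge0_integralD//; try by [move=> z _; rewrite lee_fin | exact/measurable_EFinP].
  rewrite (coupling_integral_snd gammaP mE)//.
  by rewrite lte_mul_pinfty ?lee_fin ?ltW// lte_add_pinfty.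
apply: le_lt_trans gm; apply: ge0_le_integral => //.
- by move=> z _; rewrite lee_fin.
- exact/measurable_EFinP.
- apply: emeasurable_funM => //; apply: emeasurable_funD; exact/measurable_EFinP.
- move=> z _; rewrite -EFinD -EFinM lee_fin -ler_pdivrMl// -lerBlDr.
  by rewrite le_max lexx orbT.
Qed.

(** Both sides are squares of nonnegative extended reals, where squaring reflects the order even at
    [+oo]. *)
Lemma lee_sqr_pdivr (R : realType) (a b : R) (x y : \bar R) :
  (0 < a)%R -> (0 <= b)%R -> 0 <= x -> 0 <= y ->
  (a ^+ 2)%:E * x ^+ 2 <= (b ^+ 2)%:E * y ^+ 2 -> x <= (b / a)%:E * y.
Proof.
move=> a0 b0 x0 y0; rewrite !EFin_expe !expe2 [leLHS]muleACA [leRHS]muleACA.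
rewrite -!expe2 lee_sqr ?mule_ge0 ?lee_fin ?(ltW a0)// => xy.
by rewrite mulrC EFinM -muleA lee_pdivlMl.
Qed.

Section fisher_contraction.
Context (R : realType) (X : pmetricType R) (n : nat) (S : chart_data X n).
Context (vol : set (Borel X) -> \bar R) (p : R).
Context (T : probability (Borel X) R -> probability (Borel X) R).
Context (L lambda : R) (eps : \bar R) (nu : probability (Borel X) R).
Hypotheses (p_gt0 : (0 < p)%R) (nuP : in_Pp vol (@mdist R X) p nu).
Hypotheses (smoothT : fisher_smooth S vol p T L eps nu) (fixT : T nu = nu).
Hypotheses (TI : transport_information S vol p lambda nu) (L_lt : (L < lambda)%R).

(** The inequality defining the ball is strict, so this covers [eps = +oo] as well. *)
Lemma wasserstein_ball_fin_num mu :
  wasserstein_ball vol p eps nu mu -> wasserstein p mu nu \is a fin_num.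
Proof.
move=> [_ muW]; rewrite ge0_fin_numE ?poweR_ge0//.
by rewrite (lt_le_trans muW)// leey.
Qed.

(** This makes [TI] applicable to [T mu], as it only speaks of measures dominated by [nu]. *)
Lemma fisher_smooth_dominates mu :
  wasserstein_ball vol p eps nu mu -> T mu `<< nu.
Proof.
move=> muB; have := smoothT.2 _ muB; rewrite fixT => fisher_le.
(* Without domination the Fisher information is [+oo] by definition, while its upper bound is a
   product of finite numbers. *)
apply: contrapT => /asboolPn/negbTE ndom; move: fisher_le.
rewrite /fisher_information ndom leye_eq.
by rewrite -(fineK (wasserstein_ball_fin_num muB)) -EFin_expe -EFinM.
Qed.

Lemma fisher_contraction_ratio : (0 <= L / lambda < 1)%R.
Proof.
have [[L0 _] [lambda0 _]] := (smoothT, TI).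
by rewrite divr_ge0 ?(ltW lambda0)//= ltr_pdivrMr// mul1r.
Qed.

Lemma fisher_contraction mu : wasserstein_ball vol p eps nu mu ->
  wasserstein p (T mu) nu <= (L / lambda)%:E * wasserstein p mu nu.
Proof.
(* Transport along [fixT] replaces the reference measure [T nu] of the smoothness bound by [nu], the
   one in [TI]. *)
move=> muB; have := le_trans (TI.2 _ (fisher_smooth_dominates muB))
  (eq_ind _ (fun m => fisher_information S vol (T mu) m <= _)
     (smoothT.2 _ muB) _ fixT).
by apply: lee_sqr_pdivr; rewrite ?poweR_ge0 ?TI.1 ?smoothT.1.
Qed.

Lemma wasserstein_ball_stable mu :
  wasserstein_ball vol p eps nu mu -> wasserstein_ball vol p eps nu (T mu).
Proof.
move=> muB; have [r0 r1] := andP fisher_contraction_ratio.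
have Wle : wasserstein p (T mu) nu <= wasserstein p mu nu.
  apply: le_trans (fisher_contraction muB) _.
  by rewrite -[leRHS]mul1e lee_wpmul2r ?poweR_ge0// lee_fin ltW.
split; last exact: le_lt_trans muB.2.
case: nuP => domnu [x0 moment]; split.
  (* Absolute continuity with respect to [vol] goes through [nu]; the moment below is taken about
     the base point [x0] of [nu]. *)
  exact: null_dominates_trans (fisher_smooth_dominates muB) domnu.
exists x0; apply: wasserstein_finite_moment moment => //.
by rewrite (le_lt_trans Wle)// ltey_eq wasserstein_ball_fin_num.
Qed.

Lemma wasserstein_ball_iter j mu :
  wasserstein_ball vol p eps nu mu -> wasserstein_ball vol p eps nu (iter j T mu).
Proof. by move=> muB; elim: j => // j ih; exact: wasserstein_ball_stable. Qed.

Lemma fisher_contraction_iter j mu : wasserstein_ball vol p eps nu mu ->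
  wasserstein p (iter j T mu) nu <= ((L / lambda) ^+ j)%:E * wasserstein p mu nu.
Proof.
move=> muB; have /andP[r0 _] := fisher_contraction_ratio.
elim: j => [|j ih]; first by rewrite expr0 mul1e.
rewrite iterS (le_trans (fisher_contraction (wasserstein_ball_iter j muB)))//.
by rewrite exprS [in leRHS]EFinM -[leRHS]muleA; apply: lee_wpmul2l.
Qed.

Lemma fisher_contraction_cvg mu : wasserstein_ball vol p eps nu mu ->
  wasserstein p (iter j T mu) nu @[j --> \oo] --> 0.
Proof.
move=> muB; have /andP[r0 r1] := fisher_contraction_ratio.
apply: (@squeeze_cvge _ _ _ _ (cst 0) _
  (fun j => ((L / lambda) ^+ j)%:E * wasserstein p mu nu)).
- by apply: nearW => j /=; rewrite poweR_ge0 fisher_contraction_iter.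
- exact: cvg_cst.
(* Writing the limit as a product with the finite initial distance reduces the claim to the
   geometric sequence, whose ratio is below 1. *)
- rewrite -[X in _ --> X](mul0e (wasserstein p mu nu)).
  apply: cvgeZr; first exact: wasserstein_ball_fin_num.
  apply: cvg_EFin; first exact: nearW.
  by apply: cvg_expr; rewrite ger0_norm.
Qed.

End fisher_contraction.

Local Close Scope ereal_scope.

Theorem theorem2 (R : realType) (X1 X2 : pmetricType R)
    (n : nat) (S : chart_data X2 n)
    (ref1 : {sigma_finite_measure set (Borel X1) -> \bar R})
    (vol : {sigma_finite_measure set (Borel X2) -> \bar R})
    (hS : complete_riemannian_manifold S)
    (hvol : volume_measure S vol)
    (p : R) (hp : 1 <= p)
    (f : Borel X1 * Borel X2 -> R) (hf : measurable_fun setT f)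
    (pi : probability (Borel X1 * Borel X2)%type R)
    (hpi : has_density (ref1 \x vol)%E (fun z => (expR (- f z))%:E) pi)
    (hpip : in_Pp (ref1 \x vol)%E (@prod_dist R X1 X2) p pi)
    (T1 : probability (Borel X2) R -> probability (Borel X1) R)
    (hT1 : optimality_map ref1 (fun x1 x2 => f (x1, x2)) T1)
    (T2 : probability (Borel X1) R -> probability (Borel X2) R)
    (hT2 : optimality_map vol (fun x2 x1 => f (x1, x2)) T2)
    (mustar : probability (Borel X2) R)
    (hstarp : in_Pp vol (@mdist R X2) p mustar)
    (hstar_def : composed_defined ref1 vol f T1 mustar)
    (hstar : mustar = T2 (T1 mustar))
    (eps2 : \bar R) (heps2 : (0 < eps2)%E)
    (L2 lambda2 : R)
    (hball_def : forall mu, wasserstein_ball vol p eps2 mustar mu ->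
       composed_defined ref1 vol f T1 mu)
    (hsmooth : fisher_smooth S vol p (T2 \o T1) L2 eps2 mustar)
    (hTI : transport_information S vol p lambda2 mustar)
    (hL : L2 < lambda2)
    (mu1 : nat -> probability (Borel X1) R)
    (mu2 : nat -> probability (Borel X2) R)
    (hcavi : sequential_cavi ref1 vol f T1 T2 mu1 mu2)
    (k : nat) (hk : (1 <= k)%N)
    (hball : wasserstein_ball vol p eps2 mustar (mu2 k)) :
  [/\ (wasserstein p (mu2 k.+1) mustar
         <= (L2 / lambda2)%:E * wasserstein p (mu2 k) mustar)%E,
      wasserstein_ball vol p eps2 mustar (mu2 k.+1),
      forall j, (k <= j)%N ->
        (wasserstein p (mu2 j.+1) mustar
           <= (L2 / lambda2)%:E * wasserstein p (mu2 j) mustar)%E,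
      forall j,
        (wasserstein p (mu2 (k + j)%N) mustar
           <= ((L2 / lambda2) ^+ j)%:E * wasserstein p (mu2 k) mustar)%E &
      wasserstein p (mu2 m) mustar @[m --> \oo] --> 0%E].
Proof.
have p0 : 0 < p by exact: lt_le_trans hp.
have fixT : (T2 \o T1) mustar = mustar by rewrite /= -hstar.
have mu2S j : mu2 j.+1 = (T2 \o T1) (mu2 j).
  by have [_ mu1E mu2E] := hcavi j; rewrite mu2E mu1E.
(* From index [k] on, the algorithm iterates one self-map on measures over [X2], so the contraction
   results apply with [mu2 k] as starting point. *)
have mu2E j : mu2 (k + j)%N = iter j (T2 \o T1) (mu2 k).
  by elim: j => [|j ih]; rewrite ?addn0// addnS mu2S ih.
have inball j : (k <= j)%N -> wasserstein_ball vol p eps2 mustar (mu2 j).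
  move=> /subnKC <-; rewrite mu2E.
  exact: (wasserstein_ball_iter p0 hstarp hsmooth fixT hTI hL).
have step j : (k <= j)%N -> (wasserstein p (mu2 j.+1) mustar
    <= (L2 / lambda2)%:E * wasserstein p (mu2 j) mustar)%E.
  move=> /inball jB; rewrite mu2S.
  exact: (fisher_contraction hsmooth fixT hTI).
split; [exact: step | exact: inball | exact: step | move=> j | ].
- rewrite mu2E.
  exact: (fisher_contraction_iter p0 hstarp hsmooth fixT hTI hL).
(* Convergence depends only on the tail, so the iterates before [k], possibly outside the ball, do
   not matter. *)
- rewrite -(cvg_shiftn k).
  under eq_fun do rewrite addnC mu2E.
  exact: (fisher_contraction_cvg p0 hstarp hsmooth fixT hTI hL).
Qed.
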